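(* Let $$P=-\alpha_{1}+\alpha_{2}x+\alpha_{3}y+\alpha_{4}xy,\qquad Q=-\beta_{1}+\beta_{3}x+\beta_{2}y+\beta_{4}xy$$ with real coefficients, and consider the system $\dot x=xP$, $\dot y=yQ$. Let $(x_{0},y_{0})\in\mathbb{R}^2$ with $x_{0}y_{0}\neq0$ be an equilibrium at which the Jacobian is nilpotent and nonzero, and put $$\sigma=x_{0}\alpha_{2}-y_{0}\alpha_{3},\qquad \tau=-y_{0}\beta_{2}+x_{0}\beta_{3},\qquad \Delta=\sigma+\tau .$$ Assume $\Delta\neq0$ and $\tau\neq0$. Then, within the region $\tau\ne0$, the locus $\{a=0\}$ consists of exactly two branches, $\sigma=0$ and $\alpha_{2}\beta_{2}=\alpha_{3}\beta_{3}$ (that is, $a=0$ if and only if one of these two conditions holds), and on each of them a common factor of $P$ and $Q$ vanishing at $(x_0,y_0)$ is explicit: (i) if $\sigma=0$ then $\alpha_{1}=y_{0}\alpha_{3}$, $\beta_{1}=x_{0}\beta_{3}$, $\alpha_{4}=-\alpha_{3}/x_{0}$, $\beta_{4}=-\beta_{2}/x_{0}$, and $$P=\frac{\alpha_{3}}{x_{0}}\,(x-x_{0})(y_{0}-y),\qquad Q=\frac{1}{x_{0}}\,(x-x_{0})(x_{0}\beta_{3}-\beta_{2}y),$$ so the whole line $\{x=x_{0}\}$ consists of equilibria; (ii) if $\alpha_{2}\beta_{2}=\alpha_{3}\beta_{3}$, equivalently $\beta_{2}\sigma=\alpha_{3}\tau$, then $P$ and $Q$ are proportional and the whole conic $\{Q=0\}$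 consists of equilibria. When $\beta_{2}\neq0$ one has $P=(\alpha_{3}/\beta_{2})\,Q$ (that is, $\alpha_1/\beta_1=\alpha_2/\beta_3=\alpha_3/\beta_2=\alpha_4/\beta_4$, read as proportionality of the coefficient vectors); when $\beta_{2}=0$ then $\beta_{3}\neq0$ and $P=(\alpha_{2}/\beta_{3})\,Q$.
   Context: Coefficient $a$: let $X=(xP,yQ)$, $p=(x_0,y_0)$, $J=DX(p)$, $q_0$ spanning $\ker J$, and let $(q_1,p_0,p_1)$ satisfy $Jq_1=q_0$, $J^{\top}p_1=0$, $J^{\top}p_0=p_1$, $\langle q_0,p_0\rangle=\langle q_1,p_1\rangle=1$, $\langle q_0,p_1\rangle=\langle q_1,p_0\rangle=0$. Then $a=\tfrac12\langle p_1,D^2X(p)[q_0,q_0]\rangle$; rescaling $q_0$ by $c\neq0$ multiplies $a$ by $c$, so its vanishing is well defined. *)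

(* Defs.v *)
From HB Require Import structures.
From mathcomp Require Import all_boot all_order all_algebra.
From mathcomp Require Import all_classical all_reals all_analysis.
From mathcomp Require Import -(notations) mpoly.
From mathcomp Require Import ring lra.

Set Implicit Arguments.
Unset Strict Implicit.
Unset Printing Implicit Defensive.

Import Order.TTheory GRing.Theory Num.Theory.
Import numFieldNormedType.Exports.
Local Open Scope ring_scope.

(* The notations of [mpoly] clash with those of analysis and are left out.    *)
(* Bivariate polynomials R[x, y] are [mpoly.mpoly 2 R], with x, y the         *)
(* indeterminates of index 0 and 1.                                           *)

Section Bivariate.
Variable R : realType.

Definition mconst (c : R) : mpoly.mpoly 2 R := mpoly.mpolyC 2 c.
Definition var_x : mpoly.mpoly 2 R := mpoly.mpolyX R (mpoly.mnm1 (0 : 'I_2)).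
Definition var_y : mpoly.mpoly 2 R := mpoly.mpolyX R (mpoly.mnm1 (1 : 'I_2)).

Definition bilin (c cx cy cxy : R) : mpoly.mpoly 2 R :=
  mconst c + cx *: var_x + cy *: var_y + cxy *: (var_x * var_y).

Definition pt (x y : R) : 'rV[R]_2 := \row_i [:: x; y]`_i.

Definition evalp (F : mpoly.mpoly 2 R) (z : 'rV[R]_2) : R :=
  mpoly.meval (fun i => z 0 i) F.

Definition common_factor_at (z : 'rV[R]_2) (F P Q : mpoly.mpoly 2 R) : Prop :=
  [/\ F != 0, evalp F z = 0, exists G, P = F * G & exists G, Q = F * G].

(* The vector field (x, y) |-> (x P(x, y), y Q(x, y)). *)
Definition vfield (P Q : mpoly.mpoly 2 R) (z : 'rV[R]_2) : 'rV[R]_2 :=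
  pt (z 0 0 * evalp P z) (z 0 1 * evalp Q z).

Definition equilibrium (X : 'rV[R]_2 -> 'rV[R]_2) (z : 'rV[R]_2) : Prop :=
  X z = 0.

End Bivariate.

Section NilpotentCoefficient.
Variable R : realType.

(* The library's [jacobian X z] acts on row vectors from the right, so the    *)
(* matrix with entries d X_i / d z_j, acting on columns, is its transpose.    *)
Definition Jac (X : 'rV[R]_2 -> 'rV[R]_2) (z : 'rV[R]_2) : 'M[R]_2 :=
  (jacobian X z)^T.

(* D^2 X(z)[u, v]: the derivative at z, in the direction u, of DX(.)[v]. *)
Definition D2 (X : 'rV[R]_2 -> 'rV[R]_2) (z : 'rV[R]_2) (u v : 'cV[R]_2) :
    'cV[R]_2 :=
  ('d (fun w : 'rV[R]_2 => 'd X w v^T : 'rV[R]_2) z u^T)^T.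

Definition nilpotent_matrix (A : 'M[R]_2) : Prop := exists k : nat, A ^+ k = 0.

Definition dot (u v : 'cV[R]_2) : R := \sum_i u i 0 * v i 0.

Definition spans_kernel (J : 'M[R]_2) (q : 'cV[R]_2) : Prop :=
  q != 0 /\ forall v : 'cV[R]_2, J *m v = 0 <-> exists c : R, v = c *: q.

Definition jordan_frame (J : 'M[R]_2) (q0 q1 p0 p1 : 'cV[R]_2) : Prop :=
  [/\ spans_kernel J q0, J *m q1 = q0, J^T *m p1 = 0, J^T *m p0 = p1 &
      [/\ dot q0 p0 = 1, dot q1 p1 = 1, dot q0 p1 = 0 & dot q1 p0 = 0]].

(* Such frames exist, so quantifying over all of them is not vacuous. *)
Lemma jordan_frame_exists (J : 'M[R]_2) :
  nilpotent_matrix J -> J != 0 ->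
  exists q0 q1 p0 p1 : 'cV[R]_2, jordan_frame J q0 q1 p0 p1.
Proof.
move=> [k Jk0] J0.
pose a := J 0 0; pose b := J 0 1; pose c := J 1 0; pose d := J 1 1.
have JE : J = \matrix_(i, j) [:: [:: a; b]`_j; [:: c; d]`_j]`_i.
  by apply/matrixP => i j; rewrite mxE; case: i => [[|[|?]]] //= ?;
     case: j => [[|[|?]]] //= ?; congr (J _ _); apply/val_inj.
have det0 : a * d - b * c = 0.
  have : \det J == 0.
    have : (\det J) ^+ k == 0.
      suff -> : (\det J) ^+ k = \det (J ^+ k) by rewrite Jk0 det0.
      by elim: (k) => [|m IH]; rewrite ?expr0 ?det1 // !exprS det_mulmx IH.
    by rewrite expf_eq0 => /andP[].
  rewrite JE (expand_det_row _ 0) !big_ord_recl big_ord0 /cofactor !det_mx11.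
  by rewrite !mxE /= expr0 expr1 => /eqP; lra.
have sq : J *m J = (a + d) *: J.
  rewrite JE; apply/matrixP => i j; rewrite !mxE !big_ord_recl big_ord0 !mxE.
  by case: i => [[|[|?]]] //= ?; case: j => [[|[|?]]] //= ?; lra.
have tr0 : a + d = 0.
  have JS m : J ^+ m.+1 = (a + d) ^+ m *: J.
    elim: m => [|m IH]; first by rewrite expr1 expr0 scale1r.
    rewrite exprS IH -scalerAr -[J * J]/(J *m J) sq scalerA.
    by rewrite -exprSr.
  have := JS k; rewrite exprS Jk0 mulr0 => /esym/eqP.
  by rewrite scaler_eq0 (negPf J0) orbF expf_eq0 => /andP[_ /eqP].
have {tr0}dE : d = - a by lra.
have bc : b * c = - (a * a) by move: det0; rewrite dE; lra.
pose col2 (x y : R) : 'cV[R]_2 := \col_i [:: x; y]`_i.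
have col2E (v : 'cV[R]_2) : v = col2 (v 0 0) (v 1 0).
  apply/matrixP => i j; rewrite mxE ord1.
  by case: i => [[|[|?]]] //= ?; congr (v _ _); apply/val_inj.
have Jcol x y : J *m col2 x y = col2 (a * x + b * y) (c * x + d * y).
  rewrite JE; apply/matrixP => i j; rewrite !mxE !big_ord_recl big_ord0 !mxE.
  by case: i => [[|[|?]]] //= ?; rewrite addr0.
have JTcol x y : J^T *m col2 x y = col2 (a * x + c * y) (b * x + d * y).
  rewrite JE; apply/matrixP => i j; rewrite !mxE !big_ord_recl big_ord0 !mxE.
  by case: i => [[|[|?]]] //= ?; rewrite addr0.
have dotE x y z t : dot (col2 x y) (col2 z t) = x * z + y * t.
  by rewrite /dot !big_ord_recl big_ord0 !mxE /= addr0.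
have col20 : (0 : 'cV[R]_2) = col2 0 0.
  by rewrite [LHS]col2E !mxE.
have colZ e x y : e *: col2 x y = col2 (e * x) (e * y).
  by rewrite [LHS]col2E !mxE.
have colI x y z t : col2 x y = col2 z t -> x = z /\ y = t.
  by move=> /matrixP E; split; [have := E 0 0|have := E 1 0]; rewrite !mxE.
have [c0|c0] := eqVneq c 0; last first.
  exists (col2 a c), (col2 1 0), (col2 0 c^-1), (col2 1 (- (a / c))).
  split; rewrite ?Jcol ?JTcol ?dotE ?col20.
  - split; first by apply/eqP; rewrite col20 => /colI[_ /eqP]; apply/negP.
    move=> v; split=> [|[e ->]]; last first.
      rewrite colZ Jcol dE col20; congr col2; last by ring.
      by transitivity (e * (a * a + b * c)); [ring|rewrite bc; ring].
    rewrite (col2E v) Jcol col20 => /colI[_]; rewrite dE => E.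
    exists (v 1 0 / c); rewrite colZ; congr col2; last by field.
    apply: (mulfI c0); transitivity (a * v 1 0); first by lra.
    by field.
  - by congr col2; ring.
  - congr col2; first by field.
    apply: (mulfI c0); rewrite dE.
    by transitivity (b * c + a * a); [field|rewrite bc; ring].
  - by congr col2; rewrite ?dE; field.
  - by split; field.
have a0 : a = 0.
  by have /eqP := bc; rewrite c0 mulr0 eq_sym oppr_eq0 mulf_eq0 orbb => /eqP.
have b0 : b != 0.
  apply/eqP => b0; move/eqP: J0; apply; rewrite JE dE a0 b0 c0 oppr0.
  by apply/matrixP => i j; rewrite !mxE; case: i => [[|[|?]]] //= ?;
     case: j => [[|[|?]]] //= ?.
exists (col2 b 0), (col2 0 1), (col2 b^-1 0), (col2 0 1).
split; rewrite ?Jcol ?JTcol ?dotE ?col20 ?dE ?a0 ?c0.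
- split; first by apply/eqP; rewrite col20 => /colI[/eqP + _]; apply/negP.
  move=> v; split=> [|[e ->]]; last first.
    by rewrite colZ Jcol dE a0 c0 col20; congr col2; ring.
  rewrite (col2E v) Jcol dE a0 c0 col20 => /colI[E _].
  exists (v 0 0 / b); rewrite colZ; congr col2; first by field.
  by apply: (mulfI b0); lra.
- by congr col2; ring.
- by congr col2; ring.
- by congr col2; field.
- by split; field.
Qed.

Definition coef_a (X : 'rV[R]_2 -> 'rV[R]_2) (z : 'rV[R]_2)
    (q0 p1 : 'cV[R]_2) : R :=
  2^-1 * dot p1 (D2 X z q0 q0).

End NilpotentCoefficient.

(* Main.v *)
Require Import Defs.
From HB Require Import structures.
From mathcomp Require Import all_boot all_order all_algebra.
From mathcomp Require Import all_classical all_reals all_analysis.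
From mathcomp Require Import -(notations) mpoly.
From mathcomp Require Import ring lra.

Set Implicit Arguments.
Unset Strict Implicit.
Unset Printing Implicit Defensive.

Import Order.TTheory GRing.Theory Num.Theory.
Import numFieldNormedType.Exports.
Local Open Scope ring_scope.

(* Write u = x0 P_x, so that y0 P_y = u - sigma, x0 Q_x = tau - u and          *)
(* y0 Q_y = - u at the equilibrium (the trace vanishes); the determinant then  *)
(* gives u Delta = sigma tau. The kernel of the Jacobian is spanned by         *)
(* (x0 sigma, y0 tau), its left kernel by (y0 tau, - x0 sigma), and a is a     *)
(* nonzero multiple of sigma (alpha2 beta2 - alpha3 beta3). On sigma = 0 one   *)
(* has u = 0, so P_x = P_y = Q_y = 0; on the other branch P = (sigma / tau) Q. *)

(** At an equilibrium off the axes both P and Q vanish. With k = sigma / tau, the vanishing trace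
    and determinant make the gradient of P there equal to k times that of Q. Hence P - k Q, bilinear
    and vanishing to second order at (x0, y0), is c (x - x0)(y - y0) with c = alpha4 - k beta4, and
    tau c = alpha2 beta2 - alpha3 beta3.

    The kernel vector (x0 sigma, y0 tau) is killed by both gradients, so only the xy coefficients
    survive in D^2 X[q0, q0]. Pairing with the left kernel leaves a nonzero multiple of sigma (tau
    alpha4 - sigma beta4) = sigma tau c, whence the two branches. If sigma = 0, the y-derivatives of
    P and Q vanish along x = x0, hence so do P and Q; if c = 0, then P = k Q.

    [nilpotent_det] and [nilpotent_tr] provide the scalar relations, [coef_a_vfield] an explicit
    formula for a, and [frame_kernel] the passage from an arbitrary frame to the explicit kernel
    vector. The rest is comparison of coefficients. *)

Section PlanarFields.
Variable R : realType.
Implicit Types (z v w : 'rV[R]_2) (f g : 'rV[R]_2 -> R).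

(** * Differentials of planar fields with bilinear factors *)

Lemma forall_ord2 (P : 'I_2 -> Prop) : P 0 -> P 1 -> forall i, P i.
Proof.
move=> P0 P1 i; have /orP[] : (i == 0) || (i == 1); last 2 first.
- by move/eqP->.
- by move/eqP->.
by case: i => [[|[|]]].
Qed.

Lemma pt_x (a b : R) : pt a b 0 0 = a. Proof. by rewrite mxE. Qed.
Lemma pt_y (a b : R) : pt a b 0 1 = b. Proof. by rewrite mxE. Qed.

Lemma row2P v w : v 0 0 = w 0 0 -> v 0 1 = w 0 1 -> v = w.
Proof. by move=> E0 E1; apply/rowP; apply: forall_ord2. Qed.

Lemma ptE (a b : R) : pt a b = a *: pt 1 0 + b *: pt 0 1.
Proof. by apply: row2P; rewrite !mxE /=; ring. Qed.

Lemma is_diff_coord (i : 'I_1) (j : 'I_2) z :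
  is_diff z (fun w : 'rV[R]_2 => w i j) (fun w => w i j).
Proof.
apply: DiffDef; first exact: differentiable_coord.
have lin : linear (fun w : 'rV[R]_2 => w i j : R^o).
  by move=> k u v; rewrite !mxE.
pose lM := GRing.isLinear.Build _ _ _ _ _ lin.
pose L : {linear 'rV[R]_2 -> R^o} := HB.pack (fun w : 'rV[R]_2 => w i j) lM.
exact: (@diff_lin _ _ _ L _ (@coord_continuous _ _ _ i j)).
Qed.

Lemma is_diff_pt f g df dg z : is_diff z f df -> is_diff z g dg ->
  is_diff z (fun w => pt (f w) (g w)) (fun w => pt (df w) (dg w)).
Proof.
move=> Df Dg.
have -> : (fun w => pt (f w) (g w)) =
    ((fun a : R => a *: pt 1 0) \o f) + ((fun a : R => a *: pt 0 1) \o g).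
  by apply/funext => w; rewrite ptE.
apply: is_diff_eq (is_diffD (is_diff_comp Df (is_diff_scalel _ _))
  (is_diff_comp Dg (is_diff_scalel _ _))) _.
by apply/funext => w; rewrite [RHS]ptE.
Qed.

Lemma evalp_bilin (c cx cy cxy : R) z :
  evalp (bilin c cx cy cxy) z =
  c + cx * z 0 0 + cy * z 0 1 + cxy * (z 0 0 * z 0 1).
Proof.
by rewrite /evalp /bilin !mevalD !mevalZ mevalM mevalC !mevalXU.
Qed.

(** The differential in a fixed direction v is written as a [bilin] evaluated at the base point, so
    that the same lemma differentiates it again and yields the second derivative. *)
Lemma is_diff_bilin (c cx cy cxy : R) z :
  is_diff z (evalp (bilin c cx cy cxy)) (fun v =>
    evalp (bilin (cx * v 0 0 + cy * v 0 1) (cxy * v 0 1) (cxy * v 0 0) 0) z).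
Proof.
have Dx := is_diff_coord 0 0 z; have Dy := is_diff_coord 0 1 z.
have -> : evalp (bilin c cx cy cxy) =
    cst c + cx *: (fun w => w 0 0) + cy *: (fun w => w 0 1)
    + cxy *: ((fun w => w 0 0) * (fun w => w 0 1)).
  by apply/funext => w; rewrite evalp_bilin.
apply: is_diff_eq (is_diffD (is_diffD (is_diffD (is_diff_cst c z)
  (is_diffZ cx Dx)) (is_diffZ cy Dy)) (is_diffZ cxy (is_diffM Dx Dy))) _.
apply/funext => w; rewrite evalp_bilin !fctE /GRing.scale /=.
rewrite [X in X + _ + _ + _](_ : _ = 0) //; by ring.
Qed.

Lemma is_diff_mul_coord (i : 'I_2) f df z : is_diff z f df ->
  is_diff z (fun w => w 0 i * f w) (fun v => v 0 i * f z + z 0 i * df v).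
Proof.
move=> Df; have Di := is_diff_coord 0 i z.
rewrite [X in is_diff _ X](_ : _ = (fun w => w 0 i) * f) //.
apply: is_diff_eq (is_diffM Di Df) _; apply/funext => w.
rewrite !fctE /GRing.scale /=.
by ring.
Qed.

Lemma diff_vfield (a1 a2 a3 a4 b1 b2 b3 b4 : R) z v :
  let P := bilin a1 a2 a3 a4 in let Q := bilin b1 b2 b3 b4 in
  'd (vfield P Q) z v =
  pt (v 0 0 * evalp P z + z 0 0 *
       evalp (bilin (a2 * v 0 0 + a3 * v 0 1) (a4 * v 0 1) (a4 * v 0 0) 0) z)
     (v 0 1 * evalp Q z + z 0 1 *
       evalp (bilin (b2 * v 0 0 + b3 * v 0 1) (b4 * v 0 1) (b4 * v 0 0) 0) z).
Proof.
move=> P Q; have DP := is_diff_bilin a1 a2 a3 a4 z.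
have DQ := is_diff_bilin b1 b2 b3 b4 z.
have D := is_diff_pt (is_diff_mul_coord 0 DP) (is_diff_mul_coord 1 DQ).
by rewrite (@diff_val _ _ _ _ _ _ _ D).
Qed.

Lemma diff2_vfield (a1 a2 a3 a4 b1 b2 b3 b4 : R) z v :
  let P := bilin a1 a2 a3 a4 in let Q := bilin b1 b2 b3 b4 in
  'd (fun w => 'd (vfield P Q) w v : 'rV[R]_2) z v =
  pt (2 * v 0 0 * ((a2 + a4 * z 0 1) * v 0 0 + (a3 + a4 * z 0 0) * v 0 1)
       + 2 * z 0 0 * a4 * v 0 0 * v 0 1)
     (2 * v 0 1 * ((b2 + b4 * z 0 1) * v 0 0 + (b3 + b4 * z 0 0) * v 0 1)
       + 2 * z 0 1 * b4 * v 0 0 * v 0 1).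
Proof.
move=> P Q.
under [fun w => 'd _ w v]eq_fun do rewrite diff_vfield.
(* Both components of the first differential have this shape, so one derivative serves for i = 0 and
   i = 1. *)
have D i (c cx cy cxy : R) : is_diff z (fun w => v 0 i *
      evalp (bilin c cx cy cxy) w + w 0 i * evalp (bilin (cx * v 0 0 + cy * v 0 1)
        (cxy * v 0 1) (cxy * v 0 0) 0) w)
    (fun u => v 0 i * evalp (bilin (cx * u 0 0 + cy * u 0 1) (cxy * u 0 1)
        (cxy * u 0 0) 0) z
      + (u 0 i * evalp (bilin (cx * v 0 0 + cy * v 0 1) (cxy * v 0 1)
          (cxy * v 0 0) 0) z
        + z 0 i * evalp (bilin (cxy * v 0 1 * u 0 0 + cxy * v 0 0 * u 0 1)
          (0 * u 0 1) (0 * u 0 0) 0) z)).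
  have DP := is_diff_bilin c cx cy cxy z.
  have DQ := is_diff_mul_coord i (is_diff_bilin (cx * v 0 0 + cy * v 0 1)
        (cxy * v 0 1) (cxy * v 0 0) 0 z).
  exact: (is_diffD (is_diffZ (v 0 i) DP) DQ).
rewrite (@diff_val _ _ _ _ _ _ _
  (is_diff_pt (D 0 a1 a2 a3 a4) (D 1 b1 b2 b3 b4))).
by congr pt; rewrite !evalp_bilin; ring.
Qed.

(** * Two-by-two matrices and nilpotency *)

Definition col2 (x y : R) : 'cV[R]_2 := (pt x y)^T.

Lemma col2P (u v : 'cV[R]_2) : u 0 0 = v 0 0 -> u 1 0 = v 1 0 -> u = v.
Proof.
by move=> E0 E1; apply/matrixP => i j; rewrite ord1; move: i; apply: forall_ord2.
Qed.

Lemma mx2P (A B : 'M[R]_2) : A 0 0 = B 0 0 -> A 0 1 = B 0 1 ->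
  A 1 0 = B 1 0 -> A 1 1 = B 1 1 -> A = B.
Proof.
by move=> *; apply/matrixP; apply: forall_ord2; apply: forall_ord2.
Qed.

Lemma sum2 (V : nmodType) (F : 'I_2 -> V) : \sum_i F i = F 0 + F 1.
Proof.
by rewrite !big_ord_recl big_ord0 addr0; congr (_ + F _); apply/val_inj.
Qed.

Lemma dot2 (u v : 'cV[R]_2) : dot u v = u 0 0 * v 0 0 + u 1 0 * v 1 0.
Proof. exact: sum2. Qed.

Lemma det2 (A : 'M[R]_2) : \det A = A 0 0 * A 1 1 - A 0 1 * A 1 0.
Proof.
rewrite (expand_det_row _ 0) sum2 /cofactor !det_mx11 !mxE expr0 mul1r.
rewrite expr1 mulrCA mulN1r.
by congr (_ * A _ _ - _ * A _ _); apply/val_inj.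
Qed.

Lemma nilpotent_det (A : 'M[R]_2) : nilpotent_matrix A -> \det A = 0.
Proof.
case=> k Ak0; have : \det (A ^+ k) = 0 by rewrite Ak0 det0.
have -> : \det (A ^+ k) = (\det A) ^+ k.
  by elim: (k) => [|m IH]; rewrite ?expr0 ?det1 // !exprS det_mulmx IH.
by move/eqP; rewrite expf_eq0 => /andP[_ /eqP].
Qed.

(** As the determinant is zero, Cayley-Hamilton reads A^2 = tr(A) A, so A^(m+1) = tr(A)^m A; a
    vanishing power of a nonzero A forces tr(A) = 0. *)
Lemma nilpotent_tr (A : 'M[R]_2) : nilpotent_matrix A -> \tr A = 0.
Proof.
move=> nilA; have detA := nilpotent_det nilA; case: nilA => k Ak0.
have [->|A0] := eqVneq A 0; first by rewrite mxtrace0.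
have trE : \tr A = A 0 0 + A 1 1 by rewrite /mxtrace sum2.
have sq : A * A = \tr A *: A.
  rewrite trE; move: detA; rewrite det2 => detA.
  by apply: mx2P; rewrite -[A * A]/(A *m A) !mxE !sum2; lra.
have AS m : A ^+ m.+1 = \tr A ^+ m *: A.
  elim: m => [|m IH]; first by rewrite expr0 scale1r.
  by rewrite exprS IH -scalerAr sq scalerA -exprSr.
have := AS k; rewrite exprS Ak0 mulr0 => /esym/eqP.
by rewrite scaler_eq0 (negPf A0) orbF expf_eq0 => /andP[_ /eqP].
Qed.

(** * Jacobian, coefficient a and polynomial identities for the field *)

Lemma Jac_vfield (a1 a2 a3 a4 b1 b2 b3 b4 : R) z :
  let P := bilin a1 a2 a3 a4 in let Q := bilin b1 b2 b3 b4 in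
  let J := Jac (vfield P Q) z in
  [/\ J 0 0 = evalp P z + z 0 0 * (a2 + a4 * z 0 1),
      J 0 1 = z 0 0 * (a3 + a4 * z 0 0),
      J 1 0 = z 0 1 * (b2 + b4 * z 0 1) &
      J 1 1 = evalp Q z + z 0 1 * (b3 + b4 * z 0 0)].
Proof.
move=> P Q J.
by split; rewrite !mxE diff_vfield ?pt_x ?pt_y !mxE !evalp_bilin /=; ring.
Qed.

Lemma coef_a_vfield (a1 a2 a3 a4 b1 b2 b3 b4 : R) z (q r : 'cV[R]_2) :
  let P := bilin a1 a2 a3 a4 in let Q := bilin b1 b2 b3 b4 in
  coef_a (vfield P Q) z q r =
  r 0 0 * (q 0 0 * ((a2 + a4 * z 0 1) * q 0 0 + (a3 + a4 * z 0 0) * q 1 0)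
           + z 0 0 * a4 * q 0 0 * q 1 0) +
  r 1 0 * (q 1 0 * ((b2 + b4 * z 0 1) * q 0 0 + (b3 + b4 * z 0 0) * q 1 0)
           + z 0 1 * b4 * q 0 0 * q 1 0).
Proof.
move=> P Q; rewrite /coef_a dot2 /D2 diff2_vfield !mxE /=.
by field.
Qed.

Lemma col2E (x y : R) : (col2 x y 0 0 = x) * (col2 x y 1 0 = y).
Proof. by rewrite !mxE. Qed.

Lemma mulmx_col2 (A : 'M[R]_2) (v : 'cV[R]_2) i :
  (A *m v) i 0 = A i 0 * v 0 0 + A i 1 * v 1 0.
Proof. by rewrite mxE sum2. Qed.

Lemma scale_bilin (k c cx cy cxy : R) :
  k *: bilin c cx cy cxy = bilin (k * c) (k * cx) (k * cy) (k * cxy).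
Proof. by rewrite /bilin /mconst -!mul_mpolyC !mpolyCM; ring. Qed.

(** Serves both factorizations on the branch sigma = 0: c = y0, d = 1 for P, and c = x0 beta3, d =
    beta2 for Q. *)
Lemma mul_shift (a c d : R) :
  (var_x R - mconst a) * (mconst c - d *: var_y R) =
  bilin (- (a * c)) c (a * d) (- d).
Proof.
by rewrite /bilin /mconst -!mul_mpolyC !mpolyCN !mpolyCM; ring.
Qed.

(** Evaluation at (0,0), (1,0) and (0,1) isolates the linear coefficients; this is how x - x0 and Q
    are seen to be nonzero. *)
Lemma bilin_eq0 (c cx cy cxy : R) : bilin c cx cy cxy = 0 -> cx = 0 /\ cy = 0.
Proof.
move=> F0; have ev z : c + cx * z 0 0 + cy * z 0 1 + cxy * (z 0 0 * z 0 1) = 0.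
  by rewrite -evalp_bilin F0 /evalp meval0.
have := ev (pt 0 0); have := ev (pt 1 0); have := ev (pt 0 1).
by rewrite !pt_x !pt_y => *; split; lra.
Qed.

Lemma equilibrium_vfield (P Q : mpoly 2 R) z :
  evalp P z = 0 -> evalp Q z = 0 -> equilibrium (vfield P Q) z.
Proof.
by move=> P0 Q0; apply: row2P; rewrite ?pt_x ?pt_y !mxE ?P0 ?Q0 /= mulr0.
Qed.

(** A frame fixes q0 only up to scale; this relates it to a kernel vector computed by hand. *)
Lemma frame_kernel (J : 'M[R]_2) (q0 q1 p0 p1 v : 'cV[R]_2) :
  jordan_frame J q0 q1 p0 p1 -> J *m v = 0 -> v != 0 ->
  exists2 e, e != 0 & v = e *: q0.
Proof.
case=> -[_ kerJ] _ _ _ _ /kerJ[e ->] ev0; exists e => //.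
by apply: contraNneq ev0 => ->; rewrite scale0r.
Qed.

Lemma shift_bilin (a : R) : var_x R - mconst a = bilin (- a) 1 0 0.
Proof. by rewrite /bilin scale1r !scale0r !addr0 addrC /mconst mpolyCN. Qed.

End PlanarFields.

(** * Relations at the equilibrium, then the two branches *)

Theorem proposition5p6 (R : realType)
    (alpha1 alpha2 alpha3 alpha4 beta1 beta2 beta3 beta4 x0 y0 : R) :
  let P := bilin (- alpha1) alpha2 alpha3 alpha4 in
  let Q := bilin (- beta1) beta3 beta2 beta4 in
  let X := vfield P Q in
  let p := pt x0 y0 in
  let sigma := x0 * alpha2 - y0 * alpha3 in
  let tau := - (y0 * beta2) + x0 * beta3 in
  let Delta := sigma + tau in
  x0 * y0 != 0 ->
  equilibrium X p ->
  nilpotent_matrix (Jac X p) -> Jac X p != 0 ->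
  Delta != 0 -> tau != 0 ->
  [/\ forall q0 q1 p0 p1 : 'cV[R]_2, jordan_frame (Jac X p) q0 q1 p0 p1 ->
        (coef_a X p q0 p1 = 0 <->
         sigma = 0 \/ alpha2 * beta2 = alpha3 * beta3),
      sigma = 0 ->
        [/\ [/\ alpha1 = y0 * alpha3, beta1 = x0 * beta3,
                alpha4 = - alpha3 / x0 & beta4 = - beta2 / x0],
            P = (alpha3 / x0) *: ((var_x R - mconst x0) * (mconst y0 - var_y R)),
            Q = x0^-1 *: ((var_x R - mconst x0) *
                          (mconst (x0 * beta3) - beta2 *: var_y R)),
            common_factor_at p (var_x R - mconst x0) P Q &
            forall y : R, equilibrium X (pt x0 y)],
      alpha2 * beta2 = alpha3 * beta3 <-> beta2 * sigma = alpha3 * tau &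
      alpha2 * beta2 = alpha3 * beta3 ->
        [/\ exists k : R, P = k *: Q,
            common_factor_at p Q P Q,
            forall z : 'rV[R]_2, evalp Q z = 0 -> equilibrium X z,
            beta2 != 0 ->
              P = (alpha3 / beta2) *: Q /\
              [/\ alpha1 = alpha3 / beta2 * beta1,
                  alpha2 = alpha3 / beta2 * beta3,
                  alpha3 = alpha3 / beta2 * beta2 &
                  alpha4 = alpha3 / beta2 * beta4] &
            beta2 = 0 -> beta3 != 0 /\ P = (alpha2 / beta3) *: Q]].
Proof.
move=> P Q X p sigma tau Delta st0 eqp nilJ J0 Delta0 tau0.
have [s0 t0] : x0 != 0 /\ y0 != 0.
  by move: st0; rewrite mulf_eq0 negb_or => /andP[].
have Pp0 : evalp P p = 0.
  have /rowP/(_ 0) := eqp; rewrite pt_x pt_x mxE => /eqP.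
  by rewrite mulf_eq0 (negPf s0) => /eqP.
have Qp0 : evalp Q p = 0.
  have /rowP/(_ 1) := eqp; rewrite pt_y pt_y mxE => /eqP.
  by rewrite mulf_eq0 (negPf t0) => /eqP.
have [J00 J01 J10 J11] := Jac_vfield (- alpha1) alpha2 alpha3 alpha4
  (- beta1) beta3 beta2 beta4 p.
rewrite -/P -/Q -/X ?Pp0 ?Qp0 !add0r ?pt_x ?pt_y in J00 J01 J10 J11.
have trJ := nilpotent_tr nilJ; rewrite /mxtrace sum2 J00 J11 in trJ.
have detJ := nilpotent_det nilJ; rewrite det2 J00 J01 J10 J11 in detJ.
move: (Pp0) (Qp0); rewrite !evalp_bilin pt_x pt_y => a1E b1E.
pose u := x0 * (alpha2 + alpha4 * y0).
have uE : u * Delta = sigma * tau.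
  (* The determinant gives u tau = sigma (y0 Q_y) + sigma tau, and sigma times the trace relation
     turns sigma (y0 Q_y) into - sigma u. *)
  have := congr1 ( *%R sigma) trJ; rewrite /Delta /sigma /tau /u.
  by move: detJ; clear; lra.
have uB : y0 * (alpha3 + alpha4 * x0) = u - sigma by rewrite /u /sigma; ring.
have uC : x0 * (beta3 + beta4 * y0) = tau - u.
  by move: trJ; clear; rewrite /u /tau; lra.
have uD : y0 * (beta2 + beta4 * x0) = - u by move: trJ; clear; rewrite /u; lra.
have prop_cond : x0 * (alpha2 * beta2 - alpha3 * beta3) =
    beta2 * sigma - alpha3 * tau by rewrite /sigma /tau; ring.
have propE : alpha2 * beta2 = alpha3 * beta3 <-> beta2 * sigma = alpha3 * tau.
  split=> E; apply/subr0_eq; first by rewrite -prop_cond E subrr mulr0.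
  by apply: (mulfI s0); rewrite prop_cond E subrr mulr0.
split=> //.
- move=> q0 q1 p0 p1 frame.
  have [e e0 vE] : exists2 e, e != 0 & col2 (x0 * sigma) (y0 * tau) = e *: q0.
    apply: (frame_kernel frame).
      apply: col2P; rewrite mulmx_col2 !col2E ?J00 ?J01 ?J10 ?J11 [RHS]mxE.
        transitivity (x0 * (u * sigma + (u - sigma) * tau)).
          by rewrite -uB /u; ring.
        rewrite (_ : _ + _ = u * Delta - sigma * tau);
          last by rewrite /Delta; ring.
        by rewrite uE subrr mulr0.
      transitivity (y0 * ((tau - u) * sigma + (- u) * tau)).
        by rewrite -uC -uD; ring.
      rewrite (_ : _ + _ = sigma * tau - u * Delta); last by rewrite /Delta; ring.
      by rewrite uE subrr mulr0.
    apply/eqP => /matrixP/(_ 1 0); rewrite !mxE /= => /eqP.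
    by rewrite mulf_eq0 (negPf t0) (negPf tau0).
  have ex : e * q0 0 0 = x0 * sigma.
    by have /matrixP/(_ 0 0) := vE; rewrite col2E [RHS]mxE.
  have ey : e * q0 1 0 = y0 * tau.
    by have /matrixP/(_ 1 0) := vE; rewrite col2E [RHS]mxE.
  have [_ _ JTp1 _ [_ q1p1 _ _]] := frame.
  (* Subtracting y0 times the second row of J^T p1 = 0 from x0 times the first cancels u. *)
  have wE : y0 * tau * p1 1 0 = - (x0 * sigma * p1 0 0).
    have := congr1 (fun M : 'cV[R]_2 => x0 * M 0 0) JTp1.
    have := congr1 (fun M : 'cV[R]_2 => y0 * M 1 0) JTp1.
    rewrite !mulmx_col2.
    have tE i j : (Jac X p)^T i j = Jac X p j i by rewrite mxE.
    rewrite !tE J00 J01 J10 J11 ![(0 : 'cV_2) _ _]mxE !mulr0.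
    have := congr1 ( *%R (x0 * p1 0 0)) uB.
    have := congr1 ( *%R (y0 * p1 1 0)) uC.
    have := congr1 ( *%R (y0 * p1 1 0)) uD.
    by rewrite /u; clear; lra.
  (* Otherwise [wE] would make p1 zero, against <q1, p1> = 1. *)
  have z0 : p1 0 0 != 0.
    apply/eqP => z0; move: wE; rewrite z0 mulr0 oppr0 => /eqP.
    rewrite !mulf_eq0 (negPf t0) (negPf tau0) => /eqP w0.
    by move/eqP: q1p1; rewrite dot2 z0 w0 !mulr0 addr0 eq_sym oner_eq0.
  (* a is quadratic in q0 for fixed p1, so the factor e^2 replaces q0 by (x0 sigma, y0 tau). *)
  have aE : e ^+ 2 * coef_a X p q0 p1 =
      p1 0 0 * x0 ^+ 2 * y0 * sigma * (alpha2 * beta2 - alpha3 * beta3).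
    (* By [uE] the gradient terms cancel, leaving x0 y0 (tau alpha4 - sigma beta4). *)
    have bracketE : sigma * (x0 * (alpha2 + alpha4 * y0))
        + tau * (y0 * (alpha3 + alpha4 * x0)) + tau * (x0 * y0 * alpha4)
        - sigma * (x0 * (beta3 + beta4 * y0))
        - tau * (y0 * (beta2 + beta4 * x0)) - sigma * (x0 * y0 * beta4) =
        y0 * (x0 * (alpha2 * beta2 - alpha3 * beta3)).
      rewrite prop_cond uB uC uD -/u.
      have := congr1 ( *%R sigma) uD; have := congr1 ( *%R tau) uB.
      by move: uE; rewrite /Delta; clear; lra.
    (* The factor y0 tau lets [wE] express the second entry of p1 through the first. *)
    apply: (mulfI (mulf_neq0 t0 tau0)).
    rewrite coef_a_vfield pt_x pt_y.
    set A := alpha2 + _; set B := alpha3 + _; set C := beta3 + _.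
    set D := beta2 + _.
    transitivity (p1 0 0 * (y0 * tau) * (e * q0 0 0 * (A * (e * q0 0 0)
          + B * (e * q0 1 0)) + x0 * alpha4 * (e * q0 0 0) * (e * q0 1 0))
        + y0 * tau * p1 1 0 * (e * q0 1 0 * (C * (e * q0 0 0)
          + D * (e * q0 1 0)) + y0 * beta4 * (e * q0 0 0) * (e * q0 1 0))).
      by ring.
    rewrite wE ex ey.
    transitivity (p1 0 0 * (x0 * sigma) * (y0 * tau) * (y0 * (x0 *
        (alpha2 * beta2 - alpha3 * beta3)))); last by ring.
    by rewrite -bracketE /A /B /C /D; ring.
  split=> [a0|E].
    move/eqP: aE; rewrite a0 mulr0 eq_sym !mulf_eq0.
    rewrite (negPf z0) (negPf s0) (negPf t0) /=.
    by rewrite [alpha2 * _ - _ == 0]subr_eq0 => /orP[] /eqP; [left|right].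
  have : e ^+ 2 * coef_a X p q0 p1 == 0.
    rewrite aE; case: E => [->|->]; first by rewrite mulr0 mul0r.
    by rewrite subrr mulr0.
  by rewrite mulf_eq0 expf_eq0 (negPf e0) /= => /eqP.
- move=> sigma0.
  have u0 : u = 0.
    by move/eqP: uE; rewrite sigma0 mul0r mulf_eq0 (negPf Delta0) orbF => /eqP.
  have a4E : alpha4 = - alpha3 / x0.
    apply: (mulIf s0); rewrite divfK //; apply: (mulfI t0).
    by move: uB; rewrite u0 sigma0; clear; lra.
  have b4E : beta4 = - beta2 / x0.
    apply: (mulIf s0); rewrite divfK //; apply: (mulfI t0).
    by move: uD; rewrite u0; clear; lra.
  have a2E : alpha2 = - (alpha4 * y0).
    apply: (mulfI s0); move: u0; rewrite /u; clear; lra.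
  have a1E' : alpha1 = y0 * alpha3.
    by move: a1E; rewrite a2E; clear; lra.
  have b1E' : beta1 = x0 * beta3.
    move: b1E; rewrite b4E; clear -s0 => E.
    by apply/esym/subr0_eq; rewrite -E; field.
  have PE : P = (alpha3 / x0) *: ((var_x R - mconst x0) * (mconst y0 - var_y R)).
    have := mul_shift x0 y0 1; rewrite scale1r => ->.
    rewrite scale_bilin /P a2E a1E' a4E.
    by congr bilin; field.
  have QE : Q = x0^-1 *: ((var_x R - mconst x0) *
                          (mconst (x0 * beta3) - beta2 *: var_y R)).
    rewrite mul_shift scale_bilin /Q b1E' b4E.
    by congr bilin; field.
  split=> //.
    split.
    + by rewrite shift_bilin; apply/eqP => /bilin_eq0[/eqP]; rewrite oner_eq0.
    + by rewrite shift_bilin evalp_bilin pt_x; ring.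
    + by eexists; rewrite PE scalerAr.
    + by eexists; rewrite QE scalerAr.
  move=> y; apply: equilibrium_vfield.
    by rewrite evalp_bilin pt_x pt_y a2E a1E' a4E; field.
  by rewrite evalp_bilin pt_x pt_y b1E' b4E; field.
- move=> prop.
  have ba := propE.1 prop.
  have Q0 : Q != 0.
    apply/eqP => /bilin_eq0[b30 b20]; move/eqP: tau0; apply.
    by rewrite /tau b30 b20 !mulr0 oppr0 addr0.
  (* Stated for any k with k tau = sigma, since the ratio is used in the three forms sigma / tau,
     alpha3 / beta2 and alpha2 / beta3. *)
  have PE k : k * tau = sigma -> alpha3 = k * beta2 ->
      [/\ alpha1 = k * beta1, alpha2 = k * beta3 & alpha4 = k * beta4].
    move=> kE a3k.
    (* This is x0 P_x = k x0 Q_x; it also gives u - sigma = - k u, that is y0 P_y = k y0 Q_y, from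
       which alpha4 follows once alpha3 = k beta2. *)
    have uk : u = k * (tau - u).
      by apply: (mulfI tau0); move: uE; rewrite /Delta -kE; clear; lra.
    have kuC := congr1 ( *%R k) uC; have kuD := congr1 ( *%R k) uD.
    have a4k : alpha4 = k * beta4.
      apply: (mulfI s0); apply: (mulfI t0).
      by move: uB kuD; rewrite -kE a3k; move: uk; clear; lra.
    have a2k : alpha2 = k * beta3.
      apply: (mulfI s0); move: (erefl u) kuC; rewrite [in RHS]/u a4k.
      by move: uk; clear; lra.
    split=> //; move: a1E (congr1 ( *%R k) b1E); rewrite a2k a3k a4k; clear.
    by lra.
  have PQ k : k * tau = sigma -> alpha3 = k * beta2 -> P = k *: Q.
    by move=> E1 E2; have [E3 E4 E5] := PE _ E1 E2;
       rewrite scale_bilin mulrN -E3 -E4 -E5 -E2.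
  have k1 : sigma / tau * tau = sigma by rewrite divfK.
  have k2 : alpha3 = sigma / tau * beta2.
    by rewrite mulrAC [sigma * _]mulrC ba mulfK.
  have PkQ := PQ _ k1 k2.
  split.
  + by exists (sigma / tau).
  + split=> //; last by exists 1; rewrite mulr1.
    by exists (mconst (sigma / tau)); rewrite [Q * _]mulrC mul_mpolyC.
  + move=> z Qz0; apply: equilibrium_vfield => //.
    by rewrite PkQ /evalp mevalZ [meval _ _]Qz0 mulr0.
  + move=> b20.
    have E1 : alpha3 / beta2 * tau = sigma.
      by rewrite mulrAC -ba mulrC mulKf.
    have E2 : alpha3 = alpha3 / beta2 * beta2 by rewrite divfK.
    by have [] := PE _ E1 E2; have := PQ _ E1 E2.
  + move=> b20; have b30 : beta3 != 0.
      apply: contraNneq tau0 => b30.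
      by rewrite /tau b30 b20 !mulr0 oppr0 addr0.
    have a30 : alpha3 = 0.
      move/eqP: ba; rewrite b20 mul0r eq_sym mulf_eq0 (negPf tau0) orbF.
      by move/eqP.
    split=> //; apply: PQ; last by rewrite a30 b20 mulr0.
    by rewrite /tau /sigma a30 b20; field.
Qed.
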